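(* Let $\mathcal{O}$ be the Lie-Jordan algebra of observables of a finite-dimensional quantum system and let $\mathcal{E}_{\mathcal{D}}=\{e_a: a\in\mathcal{O}\}$ be the set of expectation value functions on the set of states $\mathcal{D}$. The Lie-Jordan algebra of observables is recovered as the algebra $\mathcal{E}_{\mathcal{D}}$ with respect to the Poisson and Jordan brackets $$\{e_a,e_b\}_{\mathcal{D}}(\rho)=\Lambda_{\mathcal{D}}(\mathrm{d}e_a,\mathrm{d}e_b)(\rho)=e_{[[a,b]]}(\rho),$$ $$(e_a,e_b)_{\mathcal{D}}(\rho)=R_{\mathcal{D}}(\mathrm{d}e_a,\mathrm{d}e_b)(\rho)+e_a(\rho)e_b(\rho)=e_{a\odot b}(\rho),$$ for $a,b\in\mathcal{O}$, $\rho\in\mathcal{D}$; that is, $a\mapsto e_a$ is an isomorphism of Lie-Jordan algebras from $(\mathcal{O},\odot,[[\cdot,\cdot]])$ onto $(\mathcal{E}_{\mathcal{D}},(\cdot,\cdot)_{\mathcal{D}},\{\cdot,\cdot\}_{\mathcal{D}})$.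
   Context: $\mathcal{A}$ is a finite-dimensional unital C*-algebra with unit $I$; $\mathcal{O}=\{a\in\mathcal{A}:a^*=a\}$, with $[[a,b]]=-\frac{i}{2}(ab-ba)$ and $a\odot b=\frac12(ab+ba)$. A Lie-Jordan algebra is a real vector space with a Lie bracket $[[\cdot,\cdot]]$ and a Jordan product $\odot$ (symmetric bilinear with $(a\odot b)\odot(a\odot a)=a\odot(b\odot(a\odot a))$) such that each $[[a,\cdot]]$ is a derivation of $\odot$ and $a\odot(b\odot c)-(a\odot b)\odot c=\mu^2\left([[a,[[b,c]]]]-[[[[a,b]],c]]\right)$ for some real $\mu\neq0$. The set of states $\mathcal{D}$ is the set of $\mathbb{R}$-linear functionals $\rho:\mathcal{O}\to\mathbb{R}$ with $\rho(I)=1$ and $\rho(a^2)\ge0$ for all $a\in\mathcal{O}$. On $\mathcal{D}$ the expectation value function of $a\in\mathcal{O}$ is $e_a(\rho)=\rho(a)$. $\Lambda_{\mathcal{D}}$ and $R_{\mathcal{D}}$ are the $(2,0)$-tensor fields on $\mathcal{D}$ (differential calculus being that of the affine hyperplane $\{\xi\in\mathcal{O}^*:\xi(I)=1\}$ containing $\mathcal{D}$) determined by $\Lambda_{\mathcal{D}}(\mathrm{d}e_a,\mathrm{d}e_b)=e_{[[a,b]]}$ and $R_{\mathcal{D}}(\mathrm{d}e_a,\mathrm{d}e_b)=e_{a\odot b}-e_ae_b$. *)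

(* Defs.v *)
From HB Require Import structures.
From mathcomp Require Import all_boot all_order all_algebra all_field.
From mathcomp Require Import complex.
From mathcomp Require Import all_classical all_reals all_analysis.

Set Implicit Arguments.
Unset Strict Implicit.
Unset Printing Implicit Defensive.

Import Order.TTheory GRing.Theory Num.Theory.
Import numFieldNormedType.Exports.

Local Open Scope classical_set_scope.
Local Open Scope complex_scope.
Local Open Scope ring_scope.

(* C*-algebra structures on a finite-dimensional unital complex algebra.      *)
(* The norm is a plain R-valued function because HB cannot join Falgebra with *)
(* NormedModule; the completeness axiom is that of a Banach space.            *)
HB.mixin Record Falgebra_isCStar (R : realType) A of Falgebra R[i] A := {
  star : A -> A;
  cnorm : A -> R;
  starK : involutive star;
  starD : {morph star : a b / a + b};
  starZ : forall (z : R[i]) (a : A), star (z *: a) = conjc z *: star a;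
  starM : forall a b : A, star (a * b) = star b * star a;
  cnorm_eq0 : forall a : A, cnorm a = 0 -> a = 0;
  cnormZ : forall (z : R[i]) (a : A), cnorm (z *: a) = Normc.normc z * cnorm a;
  cnormD : forall a b : A, cnorm (a + b) <= cnorm a + cnorm b;
  cnorm_complete : forall u : nat -> A,
    (forall e : R, 0 < e -> exists N : nat, forall m n : nat,
       (N <= m)%N -> (N <= n)%N -> cnorm (u m - u n) < e) ->
    exists l : A, forall e : R, 0 < e -> exists N : nat, forall n : nat,
      (N <= n)%N -> cnorm (u n - l) < e;
  cnormM : forall a b : A, cnorm (a * b) <= cnorm a * cnorm b;
  cnorm_star : forall a : A, cnorm (star a * a) = cnorm a ^+ 2
}.

#[short(type="finCStarType")]
HB.structure Definition FinCStar (R : realType) :=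
  {A of Falgebra R[i] A & Falgebra_isCStar R A}.

Section Observables.
Variables (R : realType) (A : finCStarType R).

Lemma star0 : star (0 : A) = 0.
Proof. by rewrite -(scale0r (0 : A)) starZ conjc0 !scale0r. Qed.

Lemma starN (a : A) : star (- a) = - star a.
Proof. by apply/eqP; rewrite -addr_eq0 -starD addNr star0. Qed.

Lemma starB (a b : A) : star (a - b) = star a - star b.
Proof. by rewrite starD starN. Qed.

Lemma star1 : star (1 : A) = 1.
Proof. by rewrite -[LHS]mul1r -{1}(starK (1 : A)) -starM mul1r starK. Qed.

Lemma starZr (r : R) (a : A) : star (r%:C *: a) = r%:C *: star a.
Proof. by rewrite starZ conjc_real. Qed.

Definition selfadjoint : {pred A} := [pred a | star a == a].

Lemma selfadjoint_zmod : zmod_closed selfadjoint.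
Proof.
split=> [|a b]; first by rewrite inE star0.
by rewrite !inE => /eqP sa /eqP sb; rewrite starB sa sb.
Qed.

HB.instance Definition _ := GRing.isZmodClosed.Build A selfadjoint
  selfadjoint_zmod.

Record obs := Obs { obs_val :> A; obs_saP : obs_val \in selfadjoint }.

HB.instance Definition _ := [isSub for obs_val].
HB.instance Definition _ := [Choice of obs by <:].
HB.instance Definition _ := [SubChoice_isSubZmodule of obs by <:].

Lemma obs_star (a : obs) : star (a : A) = a.
Proof. exact: eqP (obs_saP a). Qed.

Lemma obs_scale_subproof (r : R) (a : obs) :
  r%:C *: (a : A) \in selfadjoint.
Proof. by rewrite inE starZr obs_star. Qed.

Definition obs_scale (r : R) (a : obs) : obs := Obs (obs_scale_subproof r a).

Lemma obs_scaleA r s a : obs_scale r (obs_scale s a) = obs_scale (r * s) a.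
Proof. by apply: val_inj; rewrite /= scalerA -rmorphM. Qed.
Lemma obs_scale1 : left_id 1 obs_scale.
Proof. by move=> a; apply: val_inj; rewrite /= scale1r. Qed.
Lemma obs_scaleDr : right_distributive obs_scale +%R.
Proof. by move=> r a b; apply: val_inj; rewrite /= scalerDr. Qed.
Lemma obs_scaleDl a : {morph obs_scale^~ a : r s / r + s}.
Proof. by move=> r s; apply: val_inj; rewrite /= rmorphD scalerDl. Qed.

HB.instance Definition _ := GRing.Zmodule_isLmodule.Build R obs
  obs_scaleA obs_scale1 obs_scaleDr obs_scaleDl.

Lemma half_conj : conjc (2^-1 : R[i]) = 2^-1.
Proof. by rewrite conjc_inv conjc_nat. Qed.

Lemma half_i_conj : - conjc (- 'i%C / 2 : R[i]) = - 'i%C / 2.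
Proof.
rewrite rmorphM -mulNr; congr (_ * _); last exact: half_conj.
by apply/eqP; rewrite eq_complex /= !oppr0 opprK !eqxx.
Qed.

Lemma symm_subproof (a : A) : 2^-1 *: (a + star a) \in selfadjoint.
Proof. by rewrite inE starZ half_conj starD starK addrC. Qed.

Let symm (a : A) : obs := Obs (symm_subproof a).

Let symmK (a : obs) : symm a = a.
Proof.
apply: val_inj; rewrite /= obs_star -[X in X + X]scale1r -scalerDl scalerA.
by rewrite mulVf ?scale1r // pnatr_eq0.
Qed.

Import VectorInternalTheory.

Let n := dim A.

Let toR (a : A) : 'rV[R]_(n + n) :=
  row_mx (map_mx (@complex.Re R) (v2r a))
         (map_mx (@complex.Im R) (v2r a)).

Let ofR (x : 'rV[R]_(n + n)) : A :=
  @r2v _ A (\row_j (lsubmx x 0 j +i* rsubmx x 0 j)%C).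

Let toRK : cancel toR ofR.
Proof.
move=> a; rewrite /ofR /toR row_mxKl row_mxKr.
rewrite -[RHS]v2rK; congr (@r2v _ A _).
by apply/rowP=> j; rewrite !mxE; case: (v2r a 0 j).
Qed.

Let ofR_proj (x : 'rV[R]_(n + n)) : 'rV[R]_(n + n) := toR (symm (ofR x)).

Let toR_lin (r : R) (a b : A) : toR (r%:C *: a + b) = r *: toR a + toR b.
Proof.
rewrite /toR linearP scale_row_mx add_row_mx; congr row_mx.
  apply/rowP=> j; rewrite !mxE.
  case: (v2r a 0 j) => x y.
  by case: (v2r b 0 j) => z t /=; rewrite mul0r subr0.
apply/rowP=> j; rewrite !mxE.
case: (v2r a 0 j) => x y.
by case: (v2r b 0 j) => z t /=; rewrite mul0r addr0.
Qed.

Let ofR_lin (r : R) x y : ofR (r *: x + y) = r%:C *: ofR x + ofR y.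
Proof.
rewrite /ofR -linearP; congr (@r2v _ A _).
apply/rowP=> j; rewrite !mxE; apply/eqP.
by rewrite eq_complex /= !mul0r subr0 addr0 !eqxx.
Qed.

Let symm_lin (r : R) a b : symm (r%:C *: a + b) = r *: symm a + symm b.
Proof.
apply: val_inj; rewrite /= starD starZr addrACA -(scalerDr r%:C).
by rewrite [LHS]scalerDr !scalerA mulrC.
Qed.

Let ofR_proj_lin : linear ofR_proj.
Proof. by move=> r x y; rewrite /ofR_proj ofR_lin symm_lin -toR_lin. Qed.

Let ofR_projL : {linear 'rV[R]_(n + n) -> 'rV[R]_(n + n)} :=
  HB.pack ofR_proj (GRing.isLinear.Build _ _ _ _ ofR_proj ofR_proj_lin).

Let P := lin1_mx ofR_projL.
Let B := row_base P.

Let projE x : x *m P = toR (symm (ofR x)).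
Proof. exact: mul_rV_lin1. Qed.

Let obs_v2r (a : obs) : 'rV[R]_(\rank P) := toR a *m pinvmx B.

Let obs_r2v (w : 'rV[R]_(\rank P)) : obs := symm (ofR (w *m B)).

Let obs_v2rK : cancel obs_v2r obs_r2v.
Proof.
move=> a; rewrite /obs_v2r /obs_r2v mulmxKpV ?toRK ?symmK //.
rewrite eq_row_base; apply/submxP; exists (toR a).
by rewrite projE toRK symmK.
Qed.

Let obs_r2vK : cancel obs_r2v obs_v2r.
Proof.
move=> w; rewrite /obs_v2r /obs_r2v -projE.
have /submxP[u uE] : (w *m B <= P)%MS by rewrite -(eq_row_base P) submxMl.
rewrite uE [X in X *m pinvmx B](_ : _ = u *m P).
  by rewrite -uE mulmxKp // row_base_free.
by rewrite !projE toRK symmK.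
Qed.

Fact obs_vect_iso : {d : nat & Vector.axiom d obs}.
Proof.
exists (\rank P); exists obs_v2r; last by exists obs_r2v.
by move=> r a b; rewrite /obs_v2r toR_lin mulmxDl scalemxAl.
Qed.

HB.instance Definition _ := Lmodule_hasFinDim.Build R obs (projT2 obs_vect_iso).

Lemma lie_subproof (a b : obs) :
  (- 'i%C / 2) *: ((a : A) * (b : A) - (b : A) * (a : A)) \in selfadjoint.
Proof.
rewrite inE starZ starB !starM !obs_star -(opprB ((a : A) * (b : A))).
by rewrite scalerN -scaleNr half_i_conj.
Qed.

Lemma jordan_subproof (a b : obs) :
  2^-1 *: ((a : A) * (b : A) + (b : A) * (a : A)) \in selfadjoint.
Proof. by rewrite inE starZ half_conj starD !starM !obs_star addrC. Qed.

Lemma obs1_subproof : (1 : A) \in selfadjoint.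
Proof. by rewrite inE star1. Qed.

Lemma obs_sq_subproof (a : obs) : (a : A) ^+ 2 \in selfadjoint.
Proof. by rewrite inE expr2 starM !obs_star. Qed.

Definition lie (a b : obs) : obs := Obs (lie_subproof a b).
Definition jordan (a b : obs) : obs := Obs (jordan_subproof a b).
Definition obs1 : obs := Obs obs1_subproof.
Definition obs_sq (a : obs) : obs := Obs (obs_sq_subproof a).

End Observables.

Section States.
Variables (R : realType) (A : finCStarType R).

Definition obs_dual := 'Hom(obs A, R^o).

Definition states : set obs_dual :=
  [set rho | rho (obs1 A) = 1 /\ forall a, 0 <= rho (obs_sq a)].

Definition expval (a : obs A) : states -> R := fun rho => val rho a.

Definition expvals : set (states -> R) := range expval.

(* The direction of the hyperplane {xi | xi I = 1}. *)
Definition tangent : {vspace obs_dual} :=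
  lker (linfun (fun xi : obs_dual => xi (obs1 A))).

Lemma tangentP (xi : obs_dual) : reflect (xi (obs1 A) = 0) (xi \in tangent).
Proof.
pose ev (xi : obs_dual) : R^o := xi (obs1 A).
have ev_lin : linear ev by move=> r x y; rewrite /ev add_lfunE scale_lfunE.
pose evL : {linear obs_dual -> R^o} :=
  HB.pack ev (GRing.isLinear.Build _ _ _ _ ev ev_lin).
by rewrite memv_ker -[X in linfun X]/(evL : _ -> _) lfunE /=; apply: eqP.
Qed.

Definition cotangent := 'Hom(subvs_of tangent, R^o).

(* f is the restriction of a function F whose differential at rho along the   *)
(* hyperplane is alpha; only the values of F on the hyperplane matter. Since  *)
(* rho + t (sigma - rho) is a state for 0 <= t <= 1 and the differences       *)
(* sigma - rho of states span the tangent space, alpha is unique.             *)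
Definition is_differential (f : states -> R) (rho : states)
    (alpha : cotangent) : Prop :=
  exists F : obs_dual -> R,
    (forall sigma : states, F (val sigma) = f sigma) /\
    (forall v : subvs_of tangent,
       is_derive (0 : R) (1 : R) (fun t : R => F (val rho + t *: vsval v))
         (alpha v)).

Definition differential (f : states -> R) (rho : states) : cotangent :=
  xget 0 [set alpha | is_differential f rho alpha].

Definition tensor20 := states -> 'Hom(cotangent, 'Hom(cotangent, R^o)).

(* The covectors de_a(rho) exhaust the cotangent space at rho, so a tensor     *)
(* field is determined by its values on them.                                 *)
Definition LambdaD : tensor20 :=
  xget (fun=> 0) [set L : tensor20 | forall (a b : obs A) (rho : states),
    L rho (differential (expval a) rho) (differential (expval b) rho)
      = expval (lie a b) rho].

Definition RD : tensor20 :=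
  xget (fun=> 0) [set L : tensor20 | forall (a b : obs A) (rho : states),
    L rho (differential (expval a) rho) (differential (expval b) rho)
      = expval (jordan a b) rho - expval a rho * expval b rho].

Definition poisson_bracket (f g : states -> R) : states -> R :=
  fun rho => LambdaD rho (differential f rho) (differential g rho).

Definition jordan_bracket (f g : states -> R) : states -> R :=
  fun rho => RD rho (differential f rho) (differential g rho) + f rho * g rho.

End States.

Arguments states {R} A _.
Arguments expvals {R} A _.

Section LieJordan.
Variable R : realType.

(* The linear subspace S of V is a Lie-Jordan algebra for jor and br. *)
Record lie_jordan (V : lmodType R) (S : set V) (jor br : V -> V -> V) : Prop :=
  LieJordan {
  lj_0 : S 0;
  lj_lin : forall (r : R) x y, S x -> S y -> S (r *: x + y);
  lj_jor : forall x y, S x -> S y -> S (jor x y);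
  lj_br : forall x y, S x -> S y -> S (br x y);
  lj_jor_lin : forall (r : R) x y z, S x -> S y -> S z ->
    jor (r *: x + y) z = r *: jor x z + jor y z;
  lj_jorC : forall x y, S x -> S y -> jor x y = jor y x;
  lj_jor_id : forall x y, S x -> S y ->
    jor (jor x y) (jor x x) = jor x (jor y (jor x x));
  lj_br_linl : forall (r : R) x y z, S x -> S y -> S z ->
    br (r *: x + y) z = r *: br x z + br y z;
  lj_br_linr : forall (r : R) x y z, S x -> S y -> S z ->
    br z (r *: x + y) = r *: br z x + br z y;
  lj_br_alt : forall x, S x -> br x x = 0;
  lj_br_jacobi : forall x y z, S x -> S y -> S z ->
    br x (br y z) + br y (br z x) + br z (br x y) = 0;
  lj_derivation : forall x y z, S x -> S y -> S z ->
    br x (jor y z) = jor (br x y) z + jor y (br x z);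
  lj_associator : exists mu : R, mu != 0 /\
    forall x y z, S x -> S y -> S z ->
      jor x (jor y z) - jor (jor x y) z
        = mu ^+ 2 *: (br x (br y z) - br (br x y) z)
}.

Record lie_jordan_iso (V W : lmodType R)
    (S : set V) (jorS brS : V -> V -> V)
    (T : set W) (jorT brT : W -> W -> W) (phi : V -> W) : Prop :=
  LieJordanIso {
  lji_src : lie_jordan S jorS brS;
  lji_tgt : lie_jordan T jorT brT;
  lji_lin : forall (r : R) x y, S x -> S y ->
    phi (r *: x + y) = r *: phi x + phi y;
  lji_bij : set_bij S T phi;
  lji_jor : forall x y, S x -> S y -> phi (jorS x y) = jorT (phi x) (phi y);
  lji_br : forall x y, S x -> S y -> phi (brS x y) = brT (phi x) (phi y)
}.

End LieJordan.

(* Main.v *)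
(* The functional tau(a) = Re tr(x |-> a x) satisfies tau(a^2) > 0 for every  *)
(* observable a <> 0: left multiplication by a has real eigenvalues because   *)
(* x^* x = 0 only for x = 0, and they do not all vanish because a is not      *)
(* nilpotent. Hence every quadratic form v(a^2) is bounded by a multiple of   *)
(* tau(a^2), so tau / tau(I) is a relative interior point of the set of       *)
(* states: for each tangent vector v, tau / tau(I) + e v is a state for some  *)
(* e > 0. Therefore states separate observables, and a function on states has *)
(* at most one differential at each state, that of e_a being v |-> v(a). The  *)
(* bilinear forms rho([[a,b]]) and rho(a (.) b) - rho(a) rho(b) do not change *)
(* when multiples of I are added to a and b, so they descend to covectors.    *)
From HB Require Import structures.
Require Import Defs.
From mathcomp Require Import all_boot all_order all_algebra all_field.
From mathcomp Require Import spectral mxred complex ring lra.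
From mathcomp Require Import all_classical all_reals all_analysis.

Set Implicit Arguments.
Unset Strict Implicit.
Unset Printing Implicit Defensive.

Import Order.TTheory GRing.Theory Num.Theory.
Import numFieldNormedType.Exports.

Local Open Scope classical_set_scope.
Local Open Scope ring_scope.

(** The differentials of expectation values have to be brought under control. The functional
    [retrace] gives a relative interior point of the set of states ([states_relative_interior]).
    Hence states separate observables ([expval_inj]) and differentials are unique
    ([is_differential_unique]), so that de_a is evaluation of tangent vectors at [a]
    ([differential_expval]). This evaluation forgets exactly the multiples of I. At a state rho,
    [covector_lift] recovers from de_a the representative a - rho(a) I, linearly in the covector.
    Applying rho to the Lie and Jordan products of such representatives gives the values prescribed
    for [LambdaD] and [RD], so both tensor fields exist and the brackets of e_a and e_b are
    computed. The Lie-Jordan axioms for observables are noncommutative polynomial identities, with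
    mu = 1, and pass to the image of the homomorphism [expval] ([lie_jordan_range]). *)

(** * Matrices with real spectrum *)

Lemma trig_mx_sqr_diag (F : fieldType) n (T : 'M[F]_n) (i : 'I_n) :
  is_trig_mx T -> (T *m T) i i = T i i ^+ 2.
Proof.
move=> /is_trig_mxP Ttrig; rewrite mxE (bigD1 i) //= big1 ?addr0 ?expr2 //.
move=> j ji; have [lt_ij|lt_ji|/val_inj eq_ij] := ltngtP i j.
- by rewrite (Ttrig i j) ?mul0r.
- by rewrite (Ttrig j i) ?mulr0.
- by rewrite eq_ij eqxx in ji.
Qed.

Lemma trigonalization (C : numClosedFieldType) n (M : 'M[C]_n.+1) :
  exists T : 'M[C]_n.+1, [/\ is_trig_mx T, \tr (M *m M) = \tr (T *m T)
    & mxminpoly M = mxminpoly T].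
Proof.
have [P /unitarymx_unit Punit MP] := Schur M (ltn0Sn n).
exists (P *m M *m invmx P); rewrite -(mxminpoly_uconj M Punit).
rewrite (conjumx _ Punit); split; last by [].
  by rewrite -(conjumx _ Punit).
rewrite !mulmxA (mulmxKV Punit) [RHS]mxtrace_mulC !mulmxA (mulVmx Punit).
by rewrite mul1mx.
Qed.

(** In triangular form the trace is the sum of the squares of the eigenvalues, which are real. If it
    vanishes, so do all eigenvalues, and [M] is nilpotent. Nilpotency is phrased through the action
    on row vectors, which also covers size 0. *)
Lemma mxtrace_sqr_real_spectrum (C : numClosedFieldType) n (M : 'M[C]_n) :
    (forall z, eigenvalue M z -> z \is Num.real) ->
  0 <= \tr (M *m M) /\
  (\tr (M *m M) = 0 -> exists k, forall u : 'rV_n, iter k (mulmxr M) u = 0).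
Proof.
case: n M => [|n] M Mreal.
  by rewrite /mxtrace big_ord0; split=> // _; exists 0 => u; apply: thinmx0.
have [T [Ttrig trT minT]] := trigonalization M.
have charT := char_poly_trig Ttrig.
have Treal i : T i i \is Num.real.
  apply: Mreal; rewrite eigenvalue_root_min minT root_mxminpoly charT.
  by rewrite rootE horner_prod (bigD1 i isT) /= hornerXsubC subrr mul0r.
have T2_ge0 i : 0 <= T i i ^+ 2 by rewrite real_exprn_even_ge0.
rewrite trT /mxtrace; under eq_bigr do rewrite (trig_mx_sqr_diag _ Ttrig).
split=> [|/eqP]; first exact: sumr_ge0.
rewrite psumr_eq0 => [/allP T0|i _]; last exact: T2_ge0.
have T_diag i : T i i = 0.
  by have := T0 i (mem_index_enum i); rewrite /= sqrf_eq0 => /eqP.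
(* The characteristic polynomial of [T] is now X^(n+1), and the minimal polynomial of [M] divides
   it. *)
have /mxminpoly_minP : mxminpoly M %| char_poly T.
  by rewrite minT mxminpoly_dvd_char.
rewrite charT; under eq_bigr do rewrite T_diag subr0.
rewrite prodr_const card_ord rmorphXn /= horner_mx_X => Mn0.
have iterE k (u : 'rV_n.+1) : iter k (mulmxr M) u = u *m M ^+ k.
  elim: k => [|k IHk]; first by rewrite mulmx1.
  by rewrite iterS IHk exprSr /= mulmxA.
by exists n.+1 => u; rewrite iterE Mn0 mulmx0.
Qed.

(** * A faithful positive functional: the trace of left multiplication *)

Section Trace.
Variables (R : realType) (A : finCStarType R).
Import VectorInternalTheory.

Lemma star_mul_eq0 (x : A) : star x * x = 0 -> x = 0.
Proof.
move=> xx0; apply: cnorm_eq0; apply/eqP; rewrite -sqrf_eq0 -cnorm_star xx0.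
by rewrite -(scale0r (0 : A)) cnormZ Normc.normc0 mul0r.
Qed.

(** The C*-identity lowers the exponent by one at a time: a^(k+1) is selfadjoint and its square
    a^(2k+2) has the factor a^(k+2). *)
Lemma obs_nilpotent (a : obs A) k : (a : A) ^+ k.+1 = 0 -> a = 0.
Proof.
have starX j : star ((a : A) ^+ j) = (a : A) ^+ j.
  elim: j => [|j IHj]; first by rewrite expr0 star1.
  by rewrite [in LHS]exprS starM IHj obs_star -exprSr.
elim: k => [|k IHk] ak0; first by apply: val_inj; rewrite -[LHS]expr1.
apply/IHk/star_mul_eq0; rewrite starX -exprD addSn -addnS addnC exprD.
by rewrite ak0 mul0r.
Qed.

(** The usual Hermitian argument, with [star v * v] as an algebra-valued inner product: star v a v
    is computed in two ways. *)
Lemma obs_eigenvalue_real (a : obs A) (v : A) (z : R[i]) :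
  (a : A) * v = z *: v -> v != 0 -> z \is Num.real.
Proof.
move=> av v0; have vv0 : star v * v != 0.
  by apply: contra_neq v0 => /star_mul_eq0.
have : z *: (star v * v) = conjc z *: (star v * v).
  by rewrite scalerAr -av mulrA -{1}(obs_star a) -starM av starZ scalerAl.
move/eqP; rewrite -subr_eq0 -scalerBl scaler_eq0 (negPf vv0) orbF subr_eq0.
by move=> /eqP zz; apply/CrealP; exact: esym zz.
Qed.

Definition regular_mx (a : A) : 'M[R[i]]_(dim A) := f2mx (amull a).

Lemma regular_mxE (a v : A) : v2r v *m regular_mx a = v2r (a * v).
Proof.
have -> : a * v = amull a v by rewrite lfunE.
by rewrite [in RHS]unlock /= r2vK.
Qed.

Lemma regular_mxM (a b : A) : regular_mx (a * b) = regular_mx b *m regular_mx a.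
Proof.
apply/row_matrixP => i; rewrite !rowE mulmxA -(r2vK (delta_mx 0 i)).
by rewrite !regular_mxE mulrA.
Qed.

Lemma regular_mxP (z : R[i]) (a b : A) :
  regular_mx (z *: a + b) = z *: regular_mx a + regular_mx b.
Proof.
apply/row_matrixP => i; rewrite !rowE mulmxDr -scalemxAr -(r2vK (delta_mx 0 i)).
by rewrite !regular_mxE mulrDl linearD -scalerAl linearZ.
Qed.

Definition retrace (a : obs A) : R^o := complex.Re (\tr (regular_mx a)).

Lemma retrace_linear : linear retrace.
Proof.
move=> r a b; rewrite /retrace /= regular_mxP linearD linearZ /=.
by case: (\tr _) => x y; case: (\tr _) => z t /=; rewrite mul0r subr0.
Qed.

Lemma retrace_sq_gt0 (a : obs A) : a != 0 -> 0 < retrace (obs_sq a).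
Proof.
move=> a0; rewrite /retrace /= expr2 regular_mxM.
have [|] := @mxtrace_sqr_real_spectrum _ _ (regular_mx a).
  move=> z /eigenvalueP[v vE v0].
  apply: (@obs_eigenvalue_real a (r2v v)).
    by apply: v2r_inj; rewrite -regular_mxE r2vK vE linearZ /= r2vK.
  by apply: contra_neq v0 => /(congr1 v2r); rewrite r2vK linear0.
set t := \tr _ => t_ge0 tN0.
have t_neq0 : t != 0.
  apply: contra_neq a0 => /tN0[k kE].
  (* Iterating left multiplication by [a] on the unit produces the powers of [a]. *)
  suff ak0 : (a : A) ^+ k = 0.
    by apply: (@obs_nilpotent a k); rewrite exprS ak0 mulr0.
  have iterE j : v2r ((a : A) ^+ j)
      = iter j (mulmxr (regular_mx a)) (v2r (1 : A)).
    by elim: j => //= j <-; rewrite regular_mxE exprS.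
  by apply: v2r_inj; rewrite iterE kE linear0.
have : 0 < t by rewrite lt_def t_neq0.
by rewrite ltcE => /andP[].
Qed.

End Trace.

(** * Positive definite forms dominate all bilinear forms *)

Section BilinearForms.
Variable R : realFieldType.

Lemma bilinear_form_hom (U V : vectType R) (f : U -> V -> R^o) :
    (forall u, linear (f u)) -> (forall v, linear (f^~ v)) ->
  exists F : 'Hom(U, 'Hom(V, R^o)), forall u v, F u v = f u v.
Proof.
move=> flinr flinl.
pose g u : {linear V -> R^o} :=
  HB.pack (f u) (GRing.isLinear.Build R V R^o *:%R (f u) (flinr u)).
pose h u : 'Hom(V, R^o) := linfun (g u).
have hlin : linear h.
  move=> r x y; apply/lfunP => v.
  by rewrite add_lfunE scale_lfunE !lfunE; exact: flinl.
pose k : {linear U -> 'Hom(V, R^o)} :=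
  HB.pack h (GRing.isLinear.Build R U 'Hom(V, R^o) *:%R h hlin).
by exists (linfun k) => u v; rewrite !lfunE.
Qed.

Section PositiveDefinite.
Variables (V : vectType R) (B : 'Hom(V, 'Hom(V, R^o))).
Hypothesis B_sym : forall a b, B a b = B b a.
Hypothesis B_gt0 : forall a : V, a != 0 -> 0 < B a a.

Lemma form_ge0 a : 0 <= B a a.
Proof.
by have [->|/B_gt0/ltW//] := eqVneq a 0; rewrite linear0.
Qed.

Lemma form_cauchy_schwarz a b : B a b ^+ 2 <= B a a * B b b.
Proof.
have [->|b0] := eqVneq b 0; first by rewrite !linear0 expr0n mulr0.
have expandl (r s : R) (x y z : V) :
    B (r *: x - s *: y) z = r * B x z - s * B y z.
  by rewrite linearB /= add_lfunE opp_lfunE ![in LHS]linearZ /= !scale_lfunE.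
(* At this vector the form equals B(b,b) times the Gram determinant of [a] and [b]. *)
have := form_ge0 (B b b *: a - B a b *: b).
rewrite expandl (B_sym a (_ - _)) (B_sym b (_ - _)) !expandl (B_sym b a).
have := B_gt0 b0; move: (B a a) (B a b) (B b b) => /= x y z z0.
have -> : z * (z * x - y * y) - y * (z * y - y * z) = z * (x * z - y ^+ 2).
  by ring.
by rewrite pmulr_rge0 // subr_ge0.
Qed.

(** Positive definiteness makes [B] injective, and a space and its dual have equal dimension. *)
Lemma form_riesz (phi : 'Hom(V, R^o)) : exists u, phi = B u.
Proof.
have kerB : lker B == 0%VS.
  apply/lker0P => a b Bab; apply/eqP; rewrite -subr_eq0.
  have Bab0 : B (a - b) = 0 by rewrite linearB /= Bab subrr.
  by apply/negPn/negP => /B_gt0; rewrite Bab0 lfunE /= ltxx.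
have : phi \in limg B.
  suff -> : limg B = fullv by rewrite memvf.
  apply/eqP; rewrite eqEdim subvf limg_dim_eq ?(eqP kerB) ?capv0 //.
  by rewrite !dimvf /dim /= muln1.
by case/memv_imgP => u _ ->; exists u.
Qed.

Lemma form_bounds_functional (phi : 'Hom(V, R^o)) :
  exists2 C, 0 <= C & forall a, phi a ^+ 2 <= C * B a a.
Proof.
have [u ->] := form_riesz phi; exists (B u u); first exact: form_ge0.
by move=> a; apply: form_cauchy_schwarz.
Qed.

(** In a basis, [Q a a] is a sum of products of two coordinates of [a]. Each squared coordinate is
    bounded by a multiple of [B a a], and 2|xy| <= x^2 + y^2 handles the products. *)
Lemma form_bounds_form (Q : 'Hom(V, 'Hom(V, R^o))) :
  exists2 C, 0 < C & forall a, `|Q a a| <= C * B a a.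
Proof.
pose X := vbasis {:V}.
have /choice[C C_bound] : forall i : 'I_(\dim {:V}), exists C : R, 0 <= C /\
    forall a, coord X i a ^+ 2 <= C * B a a.
  move=> i; have [C C0 CP] := form_bounds_functional (linfun (coord X i)).
  by exists C; split=> // a; have := CP a; rewrite lfunE.
pose q (i j : 'I_(\dim {:V})) := `|Q X`_i X`_j| * ((C i + C j) / 2).
have q0 i j : 0 <= q i j.
  have [[Ci _] [Cj _]] := (C_bound i, C_bound j).
  by rewrite mulr_ge0 // divr_ge0 // addr_ge0.
(* The summand 1 makes the constant strictly positive, hence invertible. *)
exists (1 + \sum_i \sum_j q i j).
  by rewrite ltr_pwDl // sumr_ge0 // => i _; rewrite sumr_ge0.
move=> a; have Baa := form_ge0 a.
apply: (@le_trans _ _ ((\sum_i \sum_j q i j) * B a a)); last first.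
  by rewrite ler_wpM2r // lerDr.
have aE : a = \sum_i coord X i a *: X`_i by rewrite -coord_vbasis ?memvf.
have QE : Q a a = \sum_i \sum_j coord X i a * (coord X j a * Q X`_i X`_j).
  rewrite {1}aE linear_sum sum_lfunE; apply: eq_bigr => i _.
  rewrite linearZ scale_lfunE /= {2}aE linear_sum [LHS]mulr_sumr.
  by apply: eq_bigr => j _; rewrite linearZ.
rewrite QE mulr_suml.
apply: (le_trans (ler_norm_sum _ _ _)); apply: ler_sum => i _.
rewrite mulr_suml.
apply: (le_trans (ler_norm_sum _ _ _)); apply: ler_sum => j _.
have [[_ /(_ a) ai] [_ /(_ a) aj]] := (C_bound i, C_bound j).
rewrite mulrA normrM mulrC /q -mulrA; apply: ler_wpM2l => //.
move: (coord X i a) (coord X j a) (B a a) ai aj => x y z xz yz.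
suff : 2 * `|x * y| <= x ^+ 2 + y ^+ 2 by lra.
rewrite normrM -(real_normK (num_real x)) -(real_normK (num_real y)).
rewrite -subr_ge0; have := sqr_ge0 (`|x| - `|y|).
by congr (0 <= _); ring.
Qed.

End PositiveDefinite.
End BilinearForms.

(** * Polynomial identities for commutators and anticommutators *)

Section ScaledCommutators.
Variables (F : fieldType) (A : falgType F).
Import VectorInternalTheory.
Implicit Types (x y z : A) (h k r : F).

Definition anticomm h x y := h *: (x * y + y * x).
Definition commut k x y := k *: (x * y - y * x).

Let coef (i : 'I_(dim A)) x : F := v2r x 0 i.
Let coefD i x y : coef i (x + y) = coef i x + coef i y.
Proof. by rewrite /coef linearD mxE. Qed.
Let coefN i x : coef i (- x) = - coef i x.
Proof. by rewrite /coef linearN mxE. Qed.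
Let coefZ i r x : coef i (r *: x) = r * coef i x.
Proof. by rewrite /coef linearZ mxE. Qed.
Let coefP x y : (forall i, coef i x = coef i y) -> x = y.
Proof. by move=> xy; apply/v2r_inj/rowP. Qed.

(* In a fixed coordinate the noncommutative monomials become scalar atoms, so *)
(* an identity that is linear in them is left to [ring].                      *)
Ltac expand_monomials :=
  rewrite /anticomm /commut;
  rewrite ?(mulrDl, mulrDr, mulNr, mulrN, =^~ scalerAl, =^~ scalerAr, mulrA);
  apply: coefP => ?; rewrite ?(coefD, coefN, coefZ).

Lemma anticommP h r x y z :
  anticomm h (r *: x + y) z = r *: anticomm h x z + anticomm h y z.
Proof. by expand_monomials; ring. Qed.

Lemma commutP k r x y z :
  commut k (r *: x + y) z = r *: commut k x z + commut k y z.
Proof. by expand_monomials; ring. Qed.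

Lemma anticomm_jordan_identity h x y :
  anticomm h (anticomm h x y) (anticomm h x x)
    = anticomm h x (anticomm h y (anticomm h x x)).
Proof. by expand_monomials; ring. Qed.

Lemma commut_jacobi k x y z :
  commut k x (commut k y z) + commut k y (commut k z x)
    = - commut k z (commut k x y).
Proof. by expand_monomials; ring. Qed.

Lemma commut_derivation h k x y z :
  commut k x (anticomm h y z)
    = anticomm h (commut k x y) z + anticomm h y (commut k x z).
Proof. by expand_monomials; ring. Qed.

(** With plain commutators, the left side is h^2 [[x,z],y] and the right side is -k^2 [[x,z],y]. *)
Lemma anticomm_associator h k x y z : k ^+ 2 = - h ^+ 2 ->
  anticomm h x (anticomm h y z) - anticomm h (anticomm h x y) z
    = commut k x (commut k y z) - commut k (commut k x y) z.
Proof. by move=> kh; expand_monomials; ring: kh. Qed.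

End ScaledCommutators.

(** * The Lie-Jordan algebra of observables *)

Section LieJordanIdentities.
Variables (R : realType) (A : finCStarType R).
Implicit Types a b c : obs A.

Lemma jordanC a b : jordan a b = jordan b a.
Proof. by apply: val_inj; rewrite /= addrC. Qed.

Lemma jordan_linearl c : linear (@jordan R A ^~ c).
Proof. by move=> r a b; apply: val_inj; apply: anticommP. Qed.

Lemma jordan_linearr c : linear (@jordan R A c).
Proof. by move=> r a b; rewrite ![jordan c _]jordanC jordan_linearl. Qed.

Lemma lieC a b : lie a b = - lie b a.
Proof. by apply: val_inj; rewrite /= -scalerN opprB. Qed.

Lemma lie_linearl c : linear (@lie R A ^~ c).
Proof. by move=> r a b; apply: val_inj; apply: commutP. Qed.

Lemma lie_linearr c : linear (@lie R A c).
Proof.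
by move=> r a b; rewrite ![lie c _]lieC lie_linearl opprD scalerN.
Qed.

Lemma halfD_scale (x : A) : 2^-1 *: (x + x) = x.
Proof.
rewrite -[X in X + X]scale1r -scalerDl scalerA.
by rewrite mulVf ?scale1r // pnatr_eq0.
Qed.

Lemma jordan_sq a : jordan a a = obs_sq a.
Proof. by apply: val_inj; rewrite /= halfD_scale expr2. Qed.

Lemma jordan1 a : jordan (obs1 A) a = a.
Proof. by apply: val_inj; rewrite /= mul1r mulr1 halfD_scale. Qed.

Lemma lie1 a : lie (obs1 A) a = 0.
Proof. by apply: val_inj; rewrite /= mul1r mulr1 subrr scaler0. Qed.

Lemma jordan_identity a b :
  jordan (jordan a b) (jordan a a) = jordan a (jordan b (jordan a a)).
Proof. by apply: val_inj; apply: anticomm_jordan_identity. Qed.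

Lemma lie_jacobi a b c :
  lie a (lie b c) + lie b (lie c a) + lie c (lie a b) = 0.
Proof.
by apply/eqP; rewrite addr_eq0; apply/eqP/val_inj; apply: commut_jacobi.
Qed.

Lemma lie_derivation a b c :
  lie a (jordan b c) = jordan (lie a b) c + jordan b (lie a c).
Proof. by apply: val_inj; apply: commut_derivation. Qed.

Lemma jordan_associator a b c :
  jordan a (jordan b c) - jordan (jordan a b) c
    = lie a (lie b c) - lie (lie a b) c.
Proof.
apply: val_inj; apply: anticomm_associator.
(* (-i/2)^2 = -(1/2)^2, which is why mu = 1 works. *)
by rewrite exprMn sqrrN sqr_i mulN1r.
Qed.

Lemma obs_lie_jordan :
  lie_jordan [set: obs A] (@jordan R A) (@lie R A).
Proof.
split=> //.
- by move=> r x y z _ _ _; apply: jordan_linearl.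
- by move=> x y _ _; apply: jordanC.
- by move=> x y _ _; apply: jordan_identity.
- by move=> r x y z _ _ _; apply: lie_linearl.
- by move=> r x y z _ _ _; apply: lie_linearr.
- by move=> x _; apply: val_inj; rewrite /= subrr scaler0.
- by move=> x y z _ _ _; apply: lie_jacobi.
- by move=> x y z _ _ _; apply: lie_derivation.
- exists 1; split=> [|x y z _ _ _]; first exact: oner_neq0.
  by rewrite expr1n scale1r jordan_associator.
Qed.

End LieJordanIdentities.

Lemma dual_separates (R : realFieldType) (V : vectType R) (a : V) :
  (forall phi : 'Hom(V, R^o), phi a = 0) -> a = 0.
Proof.
move=> a0; rewrite (coord_vbasis (memvf a)) big1 // => i _.
have := a0 (linfun (coord (vbasis {:V}) i)); rewrite lfunE /= => ->.
by rewrite scale0r.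
Qed.

(** Each axiom is an equation or a closure condition in the operations, so it survives on the image
    of a homomorphism. *)
Lemma lie_jordan_range (R : realType) (V W : lmodType R)
    (jorV brV : V -> V -> V) (jorW brW : W -> W -> W) (phi : V -> W) :
    lie_jordan [set: V] jorV brV ->
    (forall r x y, phi (r *: x + y) = r *: phi x + phi y) ->
    (forall x y, phi (jorV x y) = jorW (phi x) (phi y)) ->
    (forall x y, phi (brV x y) = brW (phi x) (phi y)) ->
  lie_jordan (range phi) jorW brW.
Proof.
move=> ljV phiP phi_jor phi_br.
have phi0 : phi 0 = 0.
  by have := phiP (-1) 0 0; rewrite scaler0 addr0 scaleN1r addNr.
have phiD x y : phi (x + y) = phi x + phi y.
  by have := phiP 1 x y; rewrite !scale1r.
have phiZ r x : phi (r *: x) = r *: phi x.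
  by have := phiP r x 0; rewrite phi0 !addr0.
have phiB x y : phi (x - y) = phi x - phi y.
  by rewrite phiD -scaleN1r phiZ scaleN1r.
split.
- by exists 0.
- by move=> r _ _ [x _ <-] [y _ <-]; exists (r *: x + y).
- by move=> _ _ [x _ <-] [y _ <-]; exists (jorV x y).
- by move=> _ _ [x _ <-] [y _ <-]; exists (brV x y).
- move=> r _ _ _ [x _ <-] [y _ <-] [z _ <-].
  by rewrite -phiP -!phi_jor -phiP (lj_jor_lin ljV).
- by move=> _ _ [x _ <-] [y _ <-]; rewrite -!phi_jor (lj_jorC ljV).
- by move=> _ _ [x _ <-] [y _ <-]; rewrite -!phi_jor (lj_jor_id ljV).
- move=> r _ _ _ [x _ <-] [y _ <-] [z _ <-].
  by rewrite -phiP -!phi_br -phiP (lj_br_linl ljV).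
- move=> r _ _ _ [x _ <-] [y _ <-] [z _ <-].
  by rewrite -phiP -!phi_br -phiP (lj_br_linr ljV).
- by move=> _ [x _ <-]; rewrite -phi_br (lj_br_alt ljV).
- move=> _ _ _ [x _ <-] [y _ <-] [z _ <-].
  by rewrite -!phi_br -!phiD (lj_br_jacobi ljV).
- move=> _ _ _ [x _ <-] [y _ <-] [z _ <-].
  by rewrite -!(phi_jor, phi_br) -phiD (lj_derivation ljV).
- have [mu [mu0 muP]] := lj_associator ljV.
  exists mu; split=> // _ _ _ [x _ <-] [y _ <-] [z _ <-].
  by rewrite -!(phi_jor, phi_br) -!phiB -phiZ muP.
Qed.

(** * Interior of the state space and separation of observables *)

Section StateSpace.
Variables (R : realType) (A : finCStarType R).
Implicit Types (a b c : obs A) (rho : states A) (v phi : obs_dual A).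

Lemma obs1_neq0 : obs1 A != 0.
Proof. by apply/eqP => /(congr1 val)/eqP; rewrite /= oner_eq0. Qed.

Lemma states_relative_interior :
  exists rho : obs_dual A, forall v, v (obs1 A) = 0 ->
    exists2 e : R, 0 < e & states A (rho + e *: v).
Proof.
pose tauL : {linear obs A -> R^o} :=
  HB.pack (@retrace R A) (GRing.isLinear.Build R (obs A) R^o *:%R
    (@retrace R A) (@retrace_linear R A)).
pose tau : obs_dual A := linfun tauL.
have jordan_form phi : exists F : 'Hom(obs A, obs_dual A),
    forall a b, F a b = phi (jordan a b).
  apply: bilinear_form_hom => [a r x y | a r x y].
    by rewrite jordan_linearr linearP.
  by rewrite jordan_linearl linearP.
have [B BE] := jordan_form tau.
have tau_gt0 a : a != 0 -> 0 < tau (obs_sq a).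
  by rewrite lfunE; apply: retrace_sq_gt0.
have B_sym a b : B a b = B b a by rewrite !BE jordanC.
have B_gt0 a : a != 0 -> 0 < B a a by rewrite BE jordan_sq; exact: tau_gt0.
have tau1 : 0 < tau (obs1 A).
  by have := B_gt0 _ obs1_neq0; rewrite BE jordan1.
exists ((tau (obs1 A))^-1 *: tau) => v v1.
have [Q QE] := jordan_form v.
have [C C0 QC] := form_bounds_form B_sym B_gt0 Q.
(* The perturbed functional is tau(I)^-1 (tau + C^-1 v), and |v(a^2)| <= C tau(a^2) keeps it
   nonnegative on squares. *)
exists ((tau (obs1 A))^-1 * C^-1); first by rewrite mulr_gt0 ?invr_gt0.
split=> [|a].
  rewrite add_lfunE !scale_lfunE v1 scaler0 addr0.
  by apply: mulVf; rewrite gt_eqF.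
rewrite -scalerA -scalerDr scale_lfunE mulr_ge0 ?invr_ge0 ?(ltW tau1) //.
have := QC a; rewrite QE BE jordan_sq ler_norml => /andP[+ _].
rewrite add_lfunE scale_lfunE -[X in X <= _]mulrN -ler_pdivlMl // => h.
by rewrite -(subrr (- tau (obs_sq a))) opprK addrC lerD2l.
Qed.

Lemma expval_eq0 a : (forall rho, expval a rho = 0) -> a = 0.
Proof.
move=> a0; have [rho rhoP] := states_relative_interior.
have a0' sigma : states A sigma -> sigma a = 0.
  by move=> s; have := a0 (exist _ sigma (mem_set s)).
have state_rho : states A rho.
  have [|e _] := rhoP 0; first by rewrite lfunE.
  by rewrite scaler0 addr0.
have rho_a := a0' _ state_rho.
(* Every functional is a multiple of [rho] plus some [v] vanishing at I. Both [rho] and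
   [rho + e *: v] are states, so they vanish at [a], and so does [v]. *)
apply: dual_separates => phi; pose v := phi - phi (obs1 A) *: rho.
have [|e e0 /a0'] := rhoP v.
  rewrite add_lfunE opp_lfunE scale_lfunE (proj1 state_rho).
  by rewrite [_ *: _]mulr1 subrr.
rewrite add_lfunE scale_lfunE rho_a add0r => /eqP.
rewrite [_ == _]mulf_eq0 (gt_eqF e0) /= add_lfunE opp_lfunE scale_lfunE rho_a.
by rewrite scaler0 subr0 => /eqP.
Qed.

Lemma expvalP (r : R) a b : expval (r *: a + b) = r *: expval a + expval b.
Proof. by apply/funext => rho; rewrite /expval linearP. Qed.

Lemma expval_inj : injective (@expval R A).
Proof.
move=> a b ab; apply/eqP; rewrite -subr_eq0; apply/eqP/expval_eq0 => rho.
by rewrite addrC -scaleN1r expvalP ab scaleN1r addNr.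
Qed.

End StateSpace.

(** * Uniqueness and computation of differentials *)

Section Differentials.
Variables (R : realType) (A : finCStarType R).
Implicit Types (a b c : obs A) (rho : states A).

Lemma state_val rho : states A (val rho).
Proof. exact: set_mem (valP rho). Qed.

(** A two-sided derivative is already determined by the limit from the right. A segment starting at
    a boundary state may leave the set of states for t < 0, so agreement is available only on one
    side. *)
Lemma is_derive_eq_right (f g : R -> R) (df dg : R) :
    is_derive (0 : R) (1 : R) f df -> is_derive (0 : R) (1 : R) g dg ->
    (forall t, 0 <= t <= 1 -> f t = g t) ->
  df = dg.
Proof.
move=> f_df g_dg fg.
have [h_derivable h_val] := is_deriveB f_df g_dg.
apply/eqP; rewrite -subr_eq0 -h_val.
apply/eqP; rewrite /derive cvg_at_rightE //.
apply: cvg_lim => //; apply: cvg_near_cst.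
near=> t; rewrite /= !fctE addr0 [t *: _]mulr1.
have t01 : 0 <= t <= 1.
  apply/andP; split; near: t; first exact: nbhs_right_ge.
  exact: nbhs_right_le.
by rewrite !fg // ?lexx ?ler01 // !subrr scaler0.
Unshelve. all: by end_near. Qed.

Lemma is_derive_affine (c d : R) :
  is_derive (0 : R) (1 : R) (fun t => c + t * d) d.
Proof.
have -> : (fun t => c + t * d) = cst c + d *: (id : R -> R).
  by apply/funext => t; rewrite mulrC.
rewrite [X in is_derive _ _ _ X](_ : _ = 0 + d *: (1 : R)).
  exact: is_deriveD (is_derive_cst _ _ _) (is_deriveZ _ (is_derive_id _ _)).
by rewrite add0r [_ *: _]mulr1.
Qed.

Lemma is_differential_unique (f : states A -> R) rho alpha beta :
  is_differential f rho alpha -> is_differential f rho beta -> alpha = beta.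
Proof.
move=> [F [Ff dF]] [G [Gf dG]].
(* By convexity the segment from [rho] to a state [sigma] consists of states, where both extensions
   agree with [f]. *)
have eq_at (sigma : obs_dual A) (v : subvs_of (tangent A)) : states A sigma ->
    vsval v = sigma - val rho -> alpha v = beta v.
  move=> s vE; apply: is_derive_eq_right (dF v) (dG v) _ => t /andP[t0 t1].
  suff st : states A (val rho + t *: vsval v).
    pose tau : states A := exist _ (val rho + t *: vsval v) (mem_set st).
    by rewrite -[_ + _]/(val tau) Ff Gf.
  have [[rho1 rho_ge0] [s1 s_ge0]] := (state_val rho, s).
  rewrite vE; split=> [|a].
    rewrite add_lfunE scale_lfunE add_lfunE opp_lfunE rho1 s1 subrr scaler0.
    by rewrite addr0.
  rewrite add_lfunE scale_lfunE add_lfunE opp_lfunE.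
  have -> : (val rho) (obs_sq a)
        + t *: (sigma (obs_sq a) - (val rho) (obs_sq a))
      = (1 - t) * (val rho) (obs_sq a) + t * sigma (obs_sq a).
    by rewrite /GRing.scale /=; ring.
  by rewrite addr_ge0 // mulr_ge0 // subr_ge0.
have [rho0 rho0P] := states_relative_interior A.
have tangentB (sigma tau : obs_dual A) : states A sigma -> states A tau ->
    sigma - tau \in tangent A.
  move=> [s1 _] [t1 _]; apply/tangentP.
  by rewrite add_lfunE opp_lfunE s1 t1 subrr.
have eq_diff (sigma : obs_dual A) : states A sigma ->
    alpha (vsproj _ (sigma - val rho)) = beta (vsproj _ (sigma - val rho)).
  move=> s; apply: (eq_at sigma) => //; rewrite vsprojK //.
  exact: tangentB s (state_val rho).
apply/lfunP => v.
have v1 : vsval v (obs1 A) = 0 by apply/tangentP/subvsP.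
have [e e0 se] := rho0P _ v1.
have [|e1 _ s0] := rho0P 0; first by rewrite lfunE.
rewrite scaler0 addr0 in s0.
(* Both [rho0] and [rho0 + e *: vsval v] are states, so [v] is a multiple of a difference of two
   directions pointing from [rho] to states. *)
have vE : v = e^-1 *: (vsproj (tangent A) (rho0 + e *: vsval v - val rho)
                       - vsproj (tangent A) (rho0 - val rho)).
  rewrite -linearB /= opprD addrACA subrr addr0 addrAC subrr add0r.
  by rewrite linearZ /= vsvalK scalerA mulVf ?scale1r ?gt_eqF.
rewrite vE; move: (eq_diff _ se) (eq_diff _ s0).
move: (vsproj _ _) (vsproj _ _) => x y ex ey.
by rewrite !linearZ !linearB /= ex ey.
Qed.

Definition evaluation_covector_fun a (v : subvs_of (tangent A)) : R^o :=
  vsval v a.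

Lemma evaluation_covector_linear a : linear (evaluation_covector_fun a).
Proof.
by move=> r v w; rewrite /evaluation_covector_fun linearP add_lfunE scale_lfunE.
Qed.

HB.instance Definition _ a := GRing.isLinear.Build R (subvs_of (tangent A)) R^o
  *:%R (evaluation_covector_fun a) (evaluation_covector_linear a).

Definition evaluation_covector a : cotangent A :=
  linfun (evaluation_covector_fun a).

Lemma differential_expval a rho :
  differential (expval a) rho = evaluation_covector a.
Proof.
have da : is_differential (expval a) rho (evaluation_covector a).
  exists (fun xi => xi a); split=> // v.
  rewrite lfunE.
  have -> : (fun t : R => (val rho + t *: vsval v) a)
      = (fun t => (val rho) a + t * (vsval v) a).
    by apply/funext => t; rewrite add_lfunE scale_lfunE.
  exact: is_derive_affine.
(* [differential] is some choice of a differential; uniqueness identifies it with the one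
   exhibited. *)
apply: (@is_differential_unique (expval a) rho _ _ _ da).
exact: xgetI da.
Qed.

End Differentials.

(** * Existence of the tensor fields and the two brackets *)

Section TensorFields.
Variables (R : realType) (A : finCStarType R).
Implicit Types (a b c : obs A) (rho : states A).

Lemma lie_center (r s : R) a b :
  lie (a - r *: obs1 A) (b - s *: obs1 A) = lie a b.
Proof.
have lieBl t x y : lie (x - t *: obs1 A) y = lie x y.
  by rewrite addrC -scaleNr lie_linearl lie1 scaler0 add0r.
by rewrite lieBl lieC lieBl -lieC.
Qed.

(** The quantum covariance: the term -e_a e_b in [RD] is what centring both observables at [rho]
    produces. *)
Lemma jordan_center rho a b :
  (val rho) (jordan (a - (val rho) a *: obs1 A) (b - (val rho) b *: obs1 A))
    = expval (jordan a b) rho - expval a rho * expval b rho.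
Proof.
have [rho1 _] := state_val rho.
have jordanBl (t : R) x y : jordan (x - t *: obs1 A) y = jordan x y - t *: y.
  by rewrite addrC -scaleNr jordan_linearl jordan1 addrC scaleNr.
have rhoB (t : R) (x y : obs A) :
    (val rho) (x - t *: y) = (val rho) x - t * (val rho) y.
  by rewrite linearB linearZ.
rewrite jordanBl jordanC jordanBl (jordanC b) !rhoB rho1 mulr1 subrr mulr0.
by rewrite subr0 mulrC.
Qed.

(* A covector at rho is de_a for an observable a unique up to multiples of  *)
(* the unit; the lift is the one on which rho vanishes.                     *)
Lemma covector_lift rho : exists lift : cotangent A -> obs A,
  linear lift /\
  forall a, lift (evaluation_covector a) = a - (val rho) a *: obs1 A.
Proof.
pose X := vbasis {:obs A}.
pose dualX (i : 'I_(\dim {:obs A})) : obs_dual A := linfun (coord X i).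
(* The dual basis projected to the tangent space along [val rho]. Evaluating [w i] at [a] gives the
   i-th coordinate of a - rho(a) I. *)
pose w i := dualX i - dualX i (obs1 A) *: val rho.
have [rho1 _] := state_val rho.
have w_tangent i : w i \in tangent A.
  apply/tangentP; rewrite add_lfunE opp_lfunE scale_lfunE rho1.
  by rewrite [_ *: _]mulr1 subrr.
exists (fun alpha => \sum_i alpha (vsproj (tangent A) (w i)) *: X`_i).
split=> [r alpha beta | a].
  rewrite scaler_sumr -big_split; apply: eq_bigr => i _.
  by rewrite add_lfunE scale_lfunE scalerDl scalerA.
rewrite {2}(coord_vbasis (memvf a)) (coord_vbasis (memvf (obs1 A))).
rewrite scaler_sumr -sumrB; apply: eq_bigr => i _.
rewrite lfunE /= /evaluation_covector_fun vsprojK // add_lfunE opp_lfunE.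
by rewrite scale_lfunE !lfunE /= scalerBl scalerA [_ *: (val rho) a]mulrC.
Qed.

(** The form [f rho], composed with the lift of covectors in both arguments, is bilinear on
    covectors, and centring turns it into [g]. Thus [g] itself may fail to be bilinear, as with the
    term -e_a e_b. *)
Lemma tensor20_exists (f g : states A -> obs A -> obs A -> R) :
    (forall rho a, linear (f rho a : obs A -> R^o)) ->
    (forall rho b, linear (f rho ^~ b : obs A -> R^o)) ->
    (forall rho a b,
      f rho (a - (val rho) a *: obs1 A) (b - (val rho) b *: obs1 A)
        = g rho a b) ->
  exists L : tensor20 A, forall a b rho,
    L rho (differential (expval a) rho) (differential (expval b) rho)
      = g rho a b.
Proof.
move=> flinr flinl fg.
suff /choice[L LP] : forall rho,
    exists F : 'Hom(cotangent A, 'Hom(cotangent A, R^o)), forall a b,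
    F (differential (expval a) rho) (differential (expval b) rho) = g rho a b.
  by exists L.
move=> rho; have [lift [lift_lin liftE]] := covector_lift rho.
have [||F FE] := @bilinear_form_hom _ (cotangent A) (cotangent A)
  (fun alpha beta => f rho (lift alpha) (lift beta)).
- by move=> alpha r x y; rewrite lift_lin flinr.
- by move=> alpha r x y; rewrite lift_lin flinl.
by exists F => a b; rewrite FE !differential_expval !liftE fg.
Qed.

Lemma LambdaD_expval a b rho :
  LambdaD rho (differential (expval a) rho) (differential (expval b) rho)
    = expval (lie a b) rho.
Proof.
have LP : exists L : tensor20 A, forall a b rho,
    L rho (differential (expval a) rho) (differential (expval b) rho)
      = expval (lie a b) rho.
  apply: (@tensor20_exists (fun rho a b => expval (lie a b) rho)).
  - by move=> {}rho c r x y; rewrite lie_linearr expvalP.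
  - by move=> {}rho c r x y; rewrite lie_linearl expvalP.
  - by move=> {a b}{}rho a b; rewrite lie_center.
(* [LambdaD] is selected by [xget]; since an admissible field exists, the selected one is admissible
   and the default 0 does not occur by failure. *)
exact: (xgetPex (fun=> 0) LP).
Qed.

Lemma RD_expval a b rho :
  RD rho (differential (expval a) rho) (differential (expval b) rho)
    = expval (jordan a b) rho - expval a rho * expval b rho.
Proof.
have LP : exists L : tensor20 A, forall a b rho,
    L rho (differential (expval a) rho) (differential (expval b) rho)
      = expval (jordan a b) rho - expval a rho * expval b rho.
  apply: (@tensor20_exists (fun rho a b => expval (jordan a b) rho)).
  - by move=> {}rho c r x y; rewrite jordan_linearr expvalP.
  - by move=> {}rho c r x y; rewrite jordan_linearl expvalP.
  - by move=> {a b}{}rho a b; rewrite -jordan_center.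
exact: (xgetPex (fun=> 0) LP).
Qed.

Lemma poisson_bracket_expval a b :
  poisson_bracket (expval a) (expval b) = expval (lie a b).
Proof. by apply/funext => rho; apply: LambdaD_expval. Qed.

Lemma jordan_bracket_expval a b :
  jordan_bracket (expval a) (expval b) = expval (jordan a b).
Proof. by apply/funext => rho; rewrite /jordan_bracket RD_expval subrK. Qed.

End TensorFields.

Theorem theorem2p17 (R : realType) (A : finCStarType R) :
  (forall (a b : obs A) (rho : states A),
     poisson_bracket (expval a) (expval b) rho
       = LambdaD rho (differential (expval a) rho)
                     (differential (expval b) rho) /\
     LambdaD rho (differential (expval a) rho) (differential (expval b) rho)
       = expval (lie a b) rho) /\
  (forall (a b : obs A) (rho : states A),
     jordan_bracket (expval a) (expval b) rho
       = RD rho (differential (expval a) rho) (differential (expval b) rho)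
         + expval a rho * expval b rho /\
     RD rho (differential (expval a) rho) (differential (expval b) rho)
         + expval a rho * expval b rho
       = expval (jordan a b) rho) /\
  lie_jordan_iso [set: obs A] (@jordan R A) (@lie R A)
    (expvals A) (@jordan_bracket R A) (@poisson_bracket R A)
    (@expval R A).
Proof.
split=> [a b rho|]; first by split=> //; apply: LambdaD_expval.
split=> [a b rho|]; first by split=> //; rewrite RD_expval subrK.
split.
- exact: obs_lie_jordan.
- apply: lie_jordan_range (obs_lie_jordan A) (@expvalP R A) _ _ => a b.
    by rewrite jordan_bracket_expval.
  by rewrite poisson_bracket_expval.
- by move=> r a b _ _; apply: expvalP.
- split=> [a _ | a b _ _ /expval_inj // | _ [a _ <-]]; by exists a.
- by move=> a b _ _; rewrite jordan_bracket_expval.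
- by move=> a b _ _; rewrite poisson_bracket_expval.
Qed.
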